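(* Let $X$ be a normal space and let $\mathscr{B}$ be a bornology on $X$ with a closed base $\mathscr{S}$. Then the topology $\mathscr{T}_{\mathscr{B}}$ on $C(X)$ is completely metrizable if and only if $(C(X),\mathscr{T}_{\mathscr{B}})$ is strongly Baire and $X$ is a $\mathscr{B}_{\mathbb{R}}$-space.
   Context: Normal spaces are assumed to be $T_1$ (convention of Engelking's ''General Topology'', to which the paper refers for undefined concepts). A bornology $\mathscr{B}$ on a nonempty set $X$ is a family of nonempty subsets of $X$ that covers $X$ and is closed under taking finite unions and under taking (nonempty) subsets. A subfamily $\mathscr{S}\subseteq\mathscr{B}$ is a base of $\mathscr{B}$ if each $B\in\mathscr{B}$ is contained in some $A\in\mathscr{S}$; it is a closed base if moreover every member of $\mathscr{S}$ is a closed subset of $X$. $C(X)$ is the set of continuous functions from $X$ to $\mathbb{R}$. The topology $\mathscr{T}_{\mathscr{B}}$ of uniform convergence on $\mathscr{B}$ is the topology on $C(X)$ induced by the uniformity $\Delta_{\mathscr{B}}$ having as a base of entourages all sets $[B;\varepsilon]=\{(f,g)\in C(X)\times C(X): |f(x)-g(x)|<\varepsilon \text{ for all } x\in B\}$, where $B\in\mathscr{B}$ and $\varepsilon>0$. $X$ is a $\mathscr{B}_{\mathbb{R}}$-space if for every function $f:X\to\mathbb{R}$, $f$ is continuous if and only if the restriction $f|_B:B\to\mathbb{R}$ is continuous for all $B\in\mathscr{B}$. Strongly Baire: let $T$ be a topological space and $D\subseteq T$ dense. In the game $\mathscr{G}_S(D)$, players $\beta$ (who moves first) and $\alpha$ alternately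 choose nonempty open subsets $V_n$ (by $\beta$) and $U_n$ (by $\alpha$) of $T$ with $V_1\supseteq U_1\supseteq V_2\supseteq U_2\supseteq\cdots$. Player $\alpha$ wins the run if $\bigcap_{n\ge1}U_n\neq\emptyset$ and every sequence $\langle x_n:n\ge1\rangle$ with $x_n\in U_n\cap D$ for all $n\ge1$ has a cluster point in $T$; otherwise $\beta$ wins. A strategy for $\beta$ is a function assigning to each legal finite sequence (including the empty one) of moves of $\alpha$ a legal next move of $\beta$; it is winning if $\beta$ wins every run played according to it. The space $T$ is strongly Baire if $T$ is regular and there is a dense subset $D\subseteq T$ such that $\beta$ has no winning strategy in $\mathscr{G}_S(D)$ played in $T$. *)

(* Defs.v *)
From HB Require Import structures.
From mathcomp Require Import all_boot all_order all_algebra finmap.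
From mathcomp Require Import all_classical all_reals all_analysis.

Set Implicit Arguments.
Unset Strict Implicit.
Unset Printing Implicit Defensive.

Import Order.TTheory GRing.Theory Num.Theory.
Import numFieldNormedType.Exports.

Local Open Scope classical_set_scope.
Local Open Scope ring_scope.

(* [setU_closed] is closure under binary unions; as every member is nonempty,
   the empty union is excluded. *)
Definition bornology (X : Type) (B : set (set X)) : Prop :=
  [/\ forall A, B A -> A !=set0,
      \bigcup_(A in B) A = [set: X],
      setU_closed B &
      forall A A', B A -> A' `<=` A -> A' !=set0 -> B A'].

Definition bornology_base (X : Type) (B S : set (set X)) : Prop :=
  S `<=` B /\ forall A, B A -> exists2 A', S A' & A `<=` A'.

Definition closed_bornology_base (X : topologicalType) (B S : set (set X)) :
    Prop :=
  bornology_base B S /\ forall A, S A -> closed A.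

(* The set of continuous real functions on X with the uniformity inherited from
   the space of all functions with uniform convergence on the members of B;
   [entourage_cont_on] gives the usual base of entourages. *)
Definition cont_on (R : realType) (X : topologicalType) (B : set (set X)) :
  Type := continuousType X R.

HB.instance Definition _ (R : realType) (X : topologicalType)
    (B : set (set X)) :=
  Uniform.copy (cont_on R B)
    (initial_topology (id : continuousType X R -> {family B, X -> R})).

Definition basic_entourage (R : realType) (X : topologicalType)
    (B : set (set X)) (A : set X) (e : R) : set (cont_on R B * cont_on R B) :=
  [set fg | forall x, A x ->
    `|(fg.1 : continuousType X R) x - (fg.2 : continuousType X R) x| < e].

Lemma entourage_cont_on (R : realType) (X : topologicalType)
    (B : set (set X)) : [set: X] !=set0 -> bornology B ->
  @entourage (cont_on R B) =
  filter_from [set Ae : set X * R | B Ae.1 /\ 0 < Ae.2]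
    (fun Ae => basic_entourage Ae.1 Ae.2).
Proof.
move=> [x0 _] [_ Bcover BU _].
set G := filter_from _ _.
have GF : Filter G.
  apply: filter_from_filter.
    have [A BA _] : (\bigcup_(A in B) A) x0 by rewrite Bcover.
    by exists (A, 1); split => //=.
  move=> [A e] [A' e'] [/= BA e0] [/= BA' e'0].
  exists (A `|` A', Num.min e e'); first by split; [exact: BU|rewrite /= lt_min e0].
  move=> fg /= H; split=> x Ax /=.
    by have := H x (or_introl Ax); rewrite lt_min => /andP[].
  by have := H x (or_intror Ax); rewrite lt_min => /andP[].
apply/seteqP; split.
- move=> E [V [W [F _ <-] WV] VE].
  suff : G (\bigcap_(p in [set` F]) [set fg : cont_on R B * cont_on R B |
      (projT1 p).2 ((fg.1 : continuousType X R) : X -> R,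
                    (fg.2 : continuousType X R) : X -> R)]).
    by apply: filterS => fg H; apply: VE; apply: WV => p Fp; exact: H.
  apply: filter_bigI => -[[[A BA] P] /= /asboolP entP] _.
  move: entP; rewrite /= uniform_entourage => -[Q + QP].
  rewrite -entourage_ballE => -[e /= e0 eQ].
  exists (A, e) => //= fg H; apply: QP => t At; apply: eQ => /=.
  exact: H.
- move=> E [[A e] /= [BA e0] AE].
  pose P := [set fg : {uniform` A -> R} * {uniform` A -> R} |
     forall t, A t -> `|fg.1 t - fg.2 t| < e].
  exists P; last by move=> fg; exact: AE.
  have entP : @entourage {uniform` A -> R} P.
    rewrite uniform_entourage; exists [set xy | ball xy.1 e xy.2] => //.
    by rewrite -entourage_ballE; exists e.
  have entP' : `[< @entourage {uniform` (projT1 (existT B A BA)) -> R} P >].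
    exact/asboolP.
  exists P => //.
  exists [fset exist (fun p : {classic {A & B A}} * _ =>
     `[< @entourage {uniform` (projT1 p.1) -> R} p.2 >]) (existT B A BA, P) entP']%fset.
    by move=> p _; exact: in_setT.
  by rewrite set_fset1 bigcap_set1.
Qed.

(* The library's completeness quantifies over Cauchy filters on a pointed type;
   for a metric it amounts to convergence of Cauchy sequences. *)
Definition complete_metric (R : realType) (M : metricType R) : Prop :=
  forall u : nat -> M, cauchy (u @ \oo) -> exists l : M, u @ \oo --> l.

(* A metric structure carries its own topology, which has to be that of T. *)
Definition completely_metrizable (R : realType) (T : topologicalType) : Prop :=
  exists2 m : Metric R T,
    forall x : T, @nbhs _ (Metric.Pack m) x = nbhs x &
    complete_metric (Metric.Pack m).

Definition BR_space (R : realType) (X : topologicalType)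
    (B : set (set X)) : Prop :=
  forall f : X -> R,
    continuous f <-> forall A, B A -> {within A, continuous f}.

Section strong_game.
Context {T : topologicalType}.
Implicit Types (s : seq (set T)) (sigma : seq (set T) -> set T).

Definition nonempty_open (A : set T) : Prop := open A /\ A !=set0.

(* A strategy of player beta maps the moves U_1, ..., U_n of player alpha to
   V_(n+1).  [legal sigma s]: the moves s of alpha are legal answers when beta
   follows sigma; sigma is only constrained on those sequences. *)
Inductive legal sigma : seq (set T) -> Prop :=
| legal_nil : legal sigma [::]
| legal_rcons s U : legal sigma s -> nonempty_open U -> U `<=` sigma s ->
    legal sigma (rcons s U).

Definition beta_strategy sigma : Prop :=
  forall s, legal sigma s ->
    nonempty_open (sigma s) /\ sigma s `<=` last [set: T] s.

(* Moves are numbered from 0. *)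
Definition game_run (V U : nat -> set T) : Prop :=
  forall n, [/\ nonempty_open (V n), nonempty_open (U n),
    U n `<=` V n & V n.+1 `<=` U n].

Definition follows sigma (V U : nat -> set T) : Prop :=
  forall n, V n = sigma (mkseq U n).

Definition alpha_wins (D : set T) (U : nat -> set T) : Prop :=
  \bigcap_n U n !=set0 /\
  forall x : nat -> T, (forall n, (U n `&` D) (x n)) ->
    cluster (x @ \oo) !=set0.

Definition beta_winning (D : set T) sigma : Prop :=
  beta_strategy sigma /\
  forall V U, game_run V U -> follows sigma V U -> ~ alpha_wins D U.

End strong_game.

(* Regular spaces are T1. *)
Definition strongly_baire (T : topologicalType) : Prop :=
  [/\ accessible_space T, regular_space T &
    exists2 D : set T, dense D & ~ exists sigma, beta_winning D sigma].

(* Main.v *)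
(* If alpha beats a strategy of beta that always shrinks to a basic neighborhood
   [close_on A e f] inside the last move, then the sets A met along the run form
   a countable base of B; so a strongly Baire C(X) is metrizable by a supremum
   distance, which is complete because over a BR-space a limit that is uniform
   on each member of the base is continuous.  Conversely, a complete distance
   gives alpha an answer to every strategy.  For the BR property we follow
   Klee's argument for topological groups: C(X) and its translate C(X) + f, for
   f continuous on each member of B, are dense and completely metrizable, hence
   meet.  By Tietze the common point is built from approximations that agree
   exactly on larger and larger sets. *)
Require Import Defs.
From HB Require Import structures.
From mathcomp Require Import all_boot all_order all_algebra.
From mathcomp Require Import all_classical all_reals all_analysis.
From mathcomp Require Import ring lra.
Import numFieldNormedType.Exports.
Local Open Scope classical_set_scope.

Import Order.TTheory GRing.Theory Num.Theory.
Set Implicit Arguments.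
Unset Strict Implicit.
Unset Printing Implicit Defensive.
Local Open Scope ring_scope.

(** * Complete metrizability in terms of real-valued distance functions *)

Section distances.
Context {R : realType}.

Definition is_distance (T : Type) (d : T -> T -> R) : Prop :=
  [/\ forall x, d x x = 0, forall x y, d x y = 0 -> x = y,
      forall x y, d x y = d y x &
      forall y x z, d x z <= d x y + d y z].

Definition distance_nbhs (T : topologicalType) (d : T -> T -> R) : Prop :=
  forall x (E : set T),
    nbhs x E <-> exists2 e : R, 0 < e & forall y, d x y < e -> E y.

(** The Cauchy condition compares late terms with [u N] only; for a distance, the triangle
    inequality makes this equivalent to comparing all pairs. *)
Definition distance_complete (T : topologicalType) (d : T -> T -> R) : Prop :=
  forall u : nat -> T,
    (forall e : R, 0 < e ->
      exists N, forall n, (N <= n)%N -> d (u N) (u n) < e) ->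
    exists l : T, u @ \oo --> l.

Section distance_space.
Context {T : choiceType} (d : T -> T -> R) (d_dist : is_distance d).

(* The dummy [let] makes the type, hence its instances, depend on [d_dist]. *)
Definition distance_space : Type := let _ := d_dist in T.

Let dxx (x : distance_space) : d x x = 0. Proof. by case: d_dist. Qed.
Let d0 (x y : distance_space) : d x y = 0 -> x = y.
Proof. by case: d_dist => _ + _ _; exact. Qed.
Let dC (x y : distance_space) : d x y = d y x. Proof. by case: d_dist. Qed.
Let dD (y x z : distance_space) : d x z <= d x y + d y z.
Proof. by case: d_dist. Qed.

HB.instance Definition _ := Choice.on distance_space.
HB.instance Definition _ :=
  isMetric.Build R distance_space dxx d0 dC dD.

End distance_space.

(** Allows a distance to be built by hand and its balls compared with the given topology, without
    bundled structures. *)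
Lemma completely_metrizableP (T : topologicalType) :
  completely_metrizable R T <->
  exists d : T -> T -> R,
    [/\ is_distance d, distance_nbhs d & distance_complete d].
Proof.
split=> [[m mnbhs mcomplete]|[d [dd dn dc]]].
- pose M : metricType R := Metric.Pack m.
  have nE (x : M) (E : set M) :
      nbhs x E <-> exists2 e : R, 0 < e & forall y, mdist x y < e -> E y.
    rewrite -nbhs_ballE; split=> -[e e0 H]; exists e => // y; last first.
      by rewrite /= ballEmdist; exact: H.
    by move=> xy; apply: H; rewrite ballEmdist.
  have dd : is_distance (@mdist R M).
    split; [exact: mdistxx|exact: mdist_positivity|exact: metric_sym|].
    by move=> y x z; exact: metric_triangle.
  exists (@mdist R M); split => //.
  + by move=> x E; rewrite -nE /M mnbhs.
  + move=> u uC.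
    have [|l ul] := mcomplete u.
      apply: cauchy_exP => e e0; have [N NP] := uC e e0.
      by exists (u N); exists N => // n /= Nn; rewrite ballEmdist; exact: NP.
    by exists l => E /=; rewrite -mnbhs; exact: ul.
- pose M : metricType R := distance_space dd.
  have mnbhs (x : T) : @nbhs _ M x = nbhs x.
    apply/seteqP; split=> E.
      rewrite -nbhs_ballE => -[e e0 H].
      by apply/dn; exists e => // y xy; apply: H; rewrite ballEmdist.
    move=> /dn[e e0 H]; rewrite -nbhs_ballE; by exists e.
  exists (Metric.class M) => //.
  move=> u /(cauchy_ballP (T := M)) uC.
  have [|l ul] := dc u.
    move=> e e0.
    have [[P Q] /= [[N _ NP] [N' _ NQ]] PQ] := uC e e0.
    exists (maxn N N') => n Nn.
    have : ball (u (maxn N N') : M) e (u n).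
      apply: (PQ (_, _)); split => /=; first by apply: NP; exact: leq_maxl.
      by apply: NQ; apply: leq_trans Nn; exact: leq_maxr.
    by rewrite ballEmdist.
  by exists l => E; rewrite /= mnbhs; exact: ul.
Qed.

End distances.

(** * Complete distances and the strong game *)

Section complete_distance.
Context {R : realType} {T : topologicalType} (d : T -> T -> R).
Hypotheses (d_dist : is_distance d) (d_nbhs : distance_nbhs d).

Definition dball (x : T) (r : R) : set T := [set y | d x y < r].

Let dxx x : d x x = 0. Proof. by case: d_dist. Qed.
Let dC x y : d x y = d y x. Proof. by case: d_dist. Qed.
Let dD y x z : d x z <= d x y + d y z. Proof. by case: d_dist. Qed.

Let d_ge0 x y : 0 <= d x y.
Proof. by have := dD y x x; rewrite dxx (dC y x); lra. Qed.

Lemma dball_open x r : open (dball x r).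
Proof.
rewrite openE => y xy; apply/d_nbhs; exists (r - d x y).
  by rewrite subr_gt0.
by move=> z; rewrite ltrBrDl; apply: le_lt_trans; exact: dD.
Qed.

Lemma dball_nbhs x r : 0 < r -> nbhs x (dball x r).
Proof. by move=> r0; apply/d_nbhs; exists r. Qed.

Lemma dball_closure x r s : r < s -> closure (dball x r) `<=` dball x s.
Proof.
move=> rs y cy; have sr0 : 0 < s - r by rewrite subr_gt0.
have [z [xz yz]] := cy _ (dball_nbhs y sr0).
by have := dD z x y; rewrite (dC z y); move: xz yz; rewrite /dball/=; lra.
Qed.

Lemma distance_accessible : accessible_space T.
Proof.
move=> x y xy; exists (dball x (d x y)); split; first exact: dball_open.
  rewrite inE /dball/= dxx lt_neqAle d_ge0 andbT eq_sym; apply: contra_neq xy.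
  by case: d_dist => _ + _ _; exact.
by rewrite inE /dball/= ltxx.
Qed.

Lemma distance_regular : regular_space T.
Proof.
move=> x E /d_nbhs[e e0 H]; exists (dball x (e / 2)).
  by apply: dball_nbhs; rewrite divr_gt0.
apply: subset_trans H; apply: dball_closure.
by rewrite ltr_pdivrMr// ltr_pMr// ltr1n.
Qed.

(* Player alpha answers with a ball [dball c r] such that [dball c (r + r)]
   fits in the last move of beta and [r] tends to 0. *)
Lemma complete_distance_strongly_baire :
  distance_complete d -> strongly_baire T.
Proof.
move=> dcomplete; split; [exact: distance_accessible|exact: distance_regular|].
exists setT; first by move=> O O0 _; rewrite setIT.
move=> [sigma [strat win]].
have [x0 _] : exists x : T, True.
  by have [[_ [x _]] _] := strat _ (legal_nil _); exists x.
have /choice[ans ansP] (Vn : set T * nat) : exists cr : T * R,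
    nonempty_open Vn.1 -> [/\ 0 < cr.2, cr.2 < Vn.2.+1%:R^-1 &
      dball cr.1 (cr.2 + cr.2) `<=` Vn.1].
  case: Vn => V n /=.
  have [[oV [c Vc]]|nV] := pselect (nonempty_open V); last by exists (x0, 0).
  have [e e0 eV] : exists2 e, 0 < e & dball c e `<=` V.
    by apply/d_nbhs; exact: open_nbhs_nbhs.
  have n0 : 0 < n.+1%:R^-1 :> R by rewrite invr_gt0 ltr0n.
  (* Halving makes the doubled radius equal to the minimum, so the doubled ball stays inside [V]. *)
  exists (c, Num.min e n.+1%:R^-1 / 2) => _ /=; rewrite -splitr.
  have m0 : 0 < Num.min e n.+1%:R^-1 by rewrite lt_min e0.
  split; first by rewrite divr_gt0.
    apply: (@lt_le_trans _ _ (Num.min e n.+1%:R^-1)).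
      by rewrite ltr_pdivrMr// ltr_pMr// ltr1n.
    by rewrite ge_min lexx orbT.
  by move=> y /lt_le_trans cy; apply: eV; apply: cy; rewrite ge_min lexx.
pose U_ V n := dball (ans (V, n)).1 (ans (V, n)).2.
pose fix s n : seq (set T) :=
  if n is m.+1 then rcons (s m) (U_ (sigma (s m)) m) else [::].
pose V n := sigma (s n); pose U n := U_ (V n) n.
pose c n := (ans (V n, n)).1; pose r n := (ans (V n, n)).2.
have ls n : legal sigma (s n).
  elim: n => [|n IH /=]; first exact: legal_nil.
  have [oV _] := strat _ IH; have [r0 _ rV] := ansP (_, n) oV.
  apply: legal_rcons => //.
    split; first exact: dball_open.
    by eexists; apply: nbhs_singleton; exact: dball_nbhs.
  by apply: subset_trans rV => y; rewrite /U_ /dball /=; lra.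
have oV n : nonempty_open (V n) by case: (strat _ (ls n)).
have rP n : [/\ 0 < r n, r n < n.+1%:R^-1 & dball (c n) (r n + r n) `<=` V n].
  by have := ansP (_, n) (oV n).
have UV n : U n `<=` V n.
  have [r0 _ rV] := rP n; apply: subset_trans rV => y.
  by rewrite /U/U_ /dball/= -/(r n) -/(c n); lra.
have cU n : U n (c n).
  by have [r0 _ _] := rP n; apply: nbhs_singleton; exact: dball_nbhs.
have VU n : V n.+1 `<=` U n.
  by have [_] := strat _ (ls n.+1); rewrite /= last_rcons.
have U_decr m n : (m <= n)%N -> U n `<=` U m.
  move=> /subnKC <-; elim: (n - m)%N => [|k IH]; first by rewrite addn0.
  by rewrite addnS; apply: subset_trans (UV _) (subset_trans (VU _) IH).
have sE n : s n = mkseq U n.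
  elim: n => //= n IH; rewrite /mkseq -addn1 iotaD map_cat /= add0n cats1.
  by rewrite -[map U _]/(mkseq U n) -IH.
(* Used twice: for the centers it yields a point in every [U n], for an arbitrary sequence it yields
   the cluster point. *)
have cvg_U (x : nat -> T) : (forall n, U n (x n)) ->
    exists2 l, x @ \oo --> l & forall n, U n l.
  move=> xU.
  have [|l xl] := dcomplete x.
    move=> e e0; have e20 : 0 < e / 2 by rewrite divr_gt0.
    have [N _ NP] := near_infty_natSinv_lt (PosNum e20).
    exists N => n Nn; have [_ rN _] := rP N.
    have {}rN : r N < e / 2 := lt_trans rN (NP N (leqnn _)).
    have := xU N; have := U_decr _ _ Nn _ (xU n).
    rewrite /U/U_/dball/= -/(r N) -/(c N) => ? ?.
    by have := dD (c N) (x N) (x n); rewrite (dC (x N) (c N)); lra.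
  (* A limit of points within [r n.+1] of the center lies within twice that radius, hence in
     [V n.+1], which is inside [U n]. *)
  exists l => // n; apply: VU; have [r0 _ rV] := rP n.+1; apply: rV.
  have [N _ NP] := xl _ (dball_nbhs l r0).
  have := NP (maxn N n.+1) (leq_maxl _ _).
  have := U_decr _ _ (leq_maxr N n.+1) _ (xU _).
  rewrite /U/U_/dball/= -/(r n.+1) -/(c n.+1) => ? ?.
  by have := dD (x (maxn N n.+1)) (c n.+1) l; rewrite (dC (x _) l); lra.
apply: (win V U).
- move=> n; split; [exact: oV| |exact: UV|exact: VU].
  by split; [exact: dball_open|exists (c n)].
- by move=> n; rewrite -sE.
split; first by have [l _ lU] := cvg_U c cU; exists l => n _.
move=> x xU; have [n|l xl _] := cvg_U x; first by case: (xU n).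
exists l => E E' xE lE'.
have xE' : (x @ \oo) E' by exact: xl.
have [N _ NP] := filterI xE xE'.
by exists (x N); apply: NP => /=.
Qed.

End complete_distance.

(** * Tietze extension for unbounded functions *)

Section unbounded_extension.
Context {R : realType} {X : topologicalType}.

(* Squeeze [f] into the interval (-1, 1) by [y / (1 + `|y|)], extend, and push
   the extension off the values 1 and -1 with a Urysohn function. *)
Lemma continuous_extension (A : set X) (f : X -> R) :
  normal_space X -> closed A -> {within A, continuous f} ->
  exists2 g : X -> R, continuous g & forall x, A x -> g x = f x.
Proof.
move=> normalX cA cf.
have den_gt0 (y : R) : 0 < 1 + `|y| by rewrite ltr_wpDr.
pose s x : R := f x / (1 + `|f x|).
have s_lt1 x : `|s x| < 1.
  rewrite /s normrM normfV (gtr0_norm (den_gt0 _)) ltr_pdivrMr ?mul1r//.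
  by rewrite ltrDr.
have cs : {within A, continuous s}.
  move=> x; apply: cvgM; first exact: cf.
  apply: cvgV; first by rewrite gt_eqF.
  by apply: cvgD; [exact: cvg_cst|apply: cvg_norm; exact: cf].
have [F [Fs cF F1]] := continuous_bounded_extension normalX cA ltr01 cs
  (fun x _ => ltW (s_lt1 x)).
have cC : closed [set x | 1 <= `|F x|].
  have cFn : continuous (fun x => `|F x| : R).
    by move=> x; apply: cvg_norm; exact: cF.
  exact: (preimage_closed (fun x _ => cFn x) (@closed_ge R 1)).
have CA0 : [set x | 1 <= `|F x|] `&` A = set0.
  apply/seteqP; split=> // x [/= + Ax].
  by rewrite -Fs ?inE// leNgt s_lt1.
have [u [cu uC uA u01]] := urysohn_ext_itv normalX cC cA CA0 (@ltr01 R).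
pose h x := u x * F x.
have ch : continuous h by move=> x; apply: cvgM; [exact: cu|exact: cF].
have h_lt1 x : `|h x| < 1.
  have /andP[u0 u1] : 0 <= u x <= 1.
    have : `[0, 1]%classic (u x) by apply: u01; exists x.
    by rewrite /= in_itv.
  rewrite /h normrM (ger0_norm u0); have [Fx|Fx] := leP 1 `|F x|.
    by rewrite (uC (u x)) ?mul0r//; exists x.
  by rewrite (le_lt_trans _ Fx)// ler_piMl.
have hA x : A x -> h x = s x.
  by move=> Ax; rewrite /h (uA (u x)) ?mul1r ?Fs ?inE//; exists x.
(* On (-1, 1) this inverts the squeezing map. *)
exists (fun x => h x / (1 - `|h x|)).
  move=> x; apply: cvgM; first exact: ch.
  apply: cvgV; first by rewrite subr_eq0 gt_eqF.
  by apply: cvgB; [exact: cvg_cst|apply: cvg_norm; exact: ch].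
move=> x Ax; rewrite hA// /s normrM normfV (gtr0_norm (den_gt0 _)).
have := den_gt0 (f x); move: `|f x| => a a0.
by field; rewrite gt_eqF//= (_ : 1 + a - a = 1) ?oner_eq0//; ring.
Qed.

End unbounded_extension.

(** * Neighborhoods in C(X) and functions prescribed on members of [S] *)

Coercion cont_on_fun (R : realType) (X : topologicalType) (B : set (set X))
  (f : cont_on R B) : X -> R := (f : continuousType X R).

Section cont_on_theory.
Context {R : realType} {X : topologicalType} {B S : set (set X)}.
Hypotheses (X_nonempty : [set: X] !=set0) (X_T1 : accessible_space X).
Hypotheses (X_normal : normal_space X) (B_bornology : bornology B).
Hypothesis S_base : closed_bornology_base B S.
Local Notation C := (cont_on R B).
Implicit Types f g h : C.

Definition close_on (A : set X) (e : R) f : set C :=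
  [set g | forall x, A x -> `|f x - g x| < e].

(** [S] is cofinal in [B], and its members are closed, so functions can be extended from the sets
    obtained here. *)
Lemma nbhs_close_on f (E : set C) :
  nbhs f E <-> exists A e, [/\ S A, 0 < e & close_on A e f `<=` E].
Proof.
have [[SB Sbase] _] := S_base.
rewrite -nbhs_entourageE /nbhs_ entourage_cont_on//; split.
  move=> [P [[A e] /= [BA e0] AP] PE]; have [A' SA' AA'] := Sbase _ BA.
  exists A', e; split=> // g fg; apply: PE; apply/xsectionP; apply: AP => x Ax.
  exact: fg (AA' _ Ax).
move=> [A [e [SA e0 AE]]].
exists (basic_entourage A e); first by exists (A, e) => //; split=> //; exact: SB.
by move=> g /xsectionP; exact: AE.
Qed.

Lemma close_on_nbhs A e f : B A -> 0 < e -> nbhs f (close_on A e f).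
Proof.
have [[_ Sbase] _] := S_base.
move=> BA e0; have [A' SA' AA'] := Sbase _ BA.
apply/nbhs_close_on; exists A', e; split=> // g fg x Ax.
exact: fg (AA' _ Ax).
Qed.

Lemma ex_cont_on (u : X -> R) :
  continuous u -> exists f : C, forall x, f x = u x.
Proof. by move=> cu; exists (mkcts cu : continuousType X R). Qed.

Lemma cont_on_cts f : continuous (f : X -> R).
Proof. exact: (@cts_fun _ _ (f : continuousType X R)). Qed.

Lemma cont_on_eq f g : f =1 g -> f = g.
Proof. by move=> fg; apply/continuousEP. Qed.

Lemma cont_on_extension (A : set X) (u : X -> R) :
  S A -> {within A, continuous u} -> exists f : C, forall x, A x -> f x = u x.
Proof.
move=> /(proj2 S_base) cA cu.
have [v cv vu] := continuous_extension X_normal cA cu.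
by have [f fv] := ex_cont_on cv; exists f => x Ax; rewrite fv vu.
Qed.

(** Add to [f] the multiple [c - f b] of a Urysohn function that is 0 on [A] and 1 at [b]; the point
    [b] is closed by T1. *)
Lemma cont_on_peak (A : set X) (b : X) f (c : R) : S A -> ~ A b ->
  exists2 g : C, forall x, A x -> g x = f x & g b = c.
Proof.
move=> SA nAb; have cA := proj2 S_base _ SA.
have cb : closed [set b] by exact: accessible_closed_set1.
have Ab0 : A `&` [set b] = set0.
  by apply/seteqP; split=> // x [/[swap] -> /=].
have [u [cu uA ub _]] := urysohn_ext_itv X_normal cA cb Ab0 (@ltr01 R).
have [g gE] := @ex_cont_on (fun x => f x + (c - f b) * u x) (fun x =>
  cvgD (@cont_on_cts f x) (cvgM (cvg_cst _) (cu x))).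
exists g => [x Ax|]; rewrite gE.
  by rewrite (uA (u x)) ?mulr0 ?addr0//; exists x.
by rewrite (ub (u b)) ?mulr1 ?subrKC//; exists b.
Qed.

(** * Countable bases of [B] from the strong game *)

Definition countable_base (A : nat -> set X) : Prop :=
  (forall n, S (A n)) /\ forall D, B D -> exists n, D `<=` A n.

(* Against the memoryless strategy playing [close_on (A n) (e n) (f n)] inside
   the previous move of alpha, the points of D in the later moves can be made
   arbitrarily large at a point outside [A n], while a cluster point is
   within 3 of [f] on every [A m]. *)
Lemma alpha_win_covers (D : set C) (A : nat -> set X) (U V : nat -> set C)
    (f_ : nat -> C) (e_ : nat -> R) (B0 : set X) :
  dense D -> game_run V U -> alpha_wins D U ->
  (forall n, [/\ S (A n), 0 < e_ n & e_ n <= 1]) ->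
  (forall n, V n.+1 = (close_on (A n) (e_ n) (f_ n))°) ->
  B B0 -> exists n, B0 `<=` A n.
Proof.
move=> dD run [[f fU] win] Ae VE BB0; have [[SB _] _] := S_base.
have VU n : V n.+1 `<=` U n by case: (run n).
have UV n : U n `<=` V n by case: (run n).
have V_decr m n : (m <= n)%N -> V n `<=` V m.
  move=> /subnKC <-; elim: (n - m)%N => [|k IH]; first by rewrite addn0.
  by rewrite addnS; apply: subset_trans (VU _) (subset_trans (UV _) IH).
have V_near n g : V n.+1 g -> forall x, A n x -> `|f_ n x - g x| < 1.
  rewrite VE => /interior_subset gn x Ax.
  by case: (Ae n) => _ _; apply: lt_le_trans; exact: gn.
(* [g] is a cluster point of elements of [D], one in each [V n.+1], that exceed [f] by more than [n]
   at [b n]. *)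
have key (b : nat -> X) : (forall n, B0 (b n) /\ ~ A n (b n)) ->
    exists g : C,
      (forall N, exists2 n, (N <= n)%N & f (b n) + n%:R - 1 < g (b n)) /\
      (forall m x, A m x -> `|f x - g x| < 3).
  move=> bP.
  have /choice[x xP] n : exists y : C,
      [/\ V n.+1 y, D y & f (b n) + n%:R < y (b n)].
    have [SA e0 _] := Ae n; have [B0b nAb] := bP n.
    (* [h] agrees with the center on [A n], so it lies in [V n.+1]; the extra 1 at [b n] is spent on
       approximating [h] over [B0] by an element of [D]. *)
    have [h hA hb] := @cont_on_peak _ _ (f_ n) (f (b n) + n%:R + 1) SA nAb.
    pose O := V n.+1 `&` (close_on B0 1 h)°.
    have hV : V n.+1 h.
      rewrite VE; apply/nbhs_close_on; exists (A n), (e_ n); split=> // g hg y Ay.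
      by rewrite -hA//; exact: hg.
    have [||y [[Vy yO] Dy]] := dD O.
    - by exists h; split=> //; exact: close_on_nbhs.
    - by apply: openI; [rewrite VE|]; exact: open_interior.
    exists y; split=> //.
    have := interior_subset yO _ B0b; rewrite hb ltr_norml => /andP[_].
    by rewrite ltrBlDl -ltrBlDr addrK.
  have [n|g gx] := win x.
    by have [Vx Dx _] := xP n; split=> //; exact: VU.
  have clus N (A' : set X) : B A' ->
      exists2 n, (N <= n)%N & forall y, A' y -> `|g y - x n y| < 1.
    move=> BA'.
    have [y [[n Nn <-] gy]] := gx [set y | exists2 n, (N <= n)%N & x n = y]
      (close_on A' 1 g) (ltac:(by exists N => // n Nn; exists n))
      (close_on_nbhs g BA' ltr01).
    by exists n.
  exists g; split=> [N|m y Ay].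
    have [n Nn gn] := clus N B0 BB0; exists n => //.
    have [_ _] := xP n; have [/gn + _] := bP n.
    by rewrite ltr_norml => /andP[]; lra.
  (* Both [f] and [x n] lie in [V m.+1], so each is within 1 of [f_ m] on [A m]; a third unit
     separates [g] from [x n]. *)
  have [SA _ _] := Ae m.
  have [n mn gn] := clus m _ (SB _ SA).
  have [Vx _ _] := xP n.
  have := V_near m f (UV _ _ (fU m.+1 I)) _ Ay.
  have := V_near m (x n) (V_decr _ _ _ _ Vx) _ Ay.
  have := gn _ Ay; rewrite !ltr_norml => /andP[? ?] /(_ mn)/andP[? ?] /andP[? ?].
  by apply/andP; split; lra.
apply: contrapT => /forallNP nB0.
(* A point of [B0] outside every [A m] gives a constant sequence, at which [g] would be infinite.
   Otherwise each [b n] lies in some [A m], where the bound 3 contradicts an excess above [n - 1]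
   with [n >= 4]. *)
have [[b B0b nAb]|cover] := pselect (exists2 b, B0 b & forall m, ~ A m b).
  have [//|g [gb _]] := key (fun=> b).
  have [n Nn] := gb (Num.bound `|g b - f b + 1|).
  have := archi_boundP (normr_ge0 (g b - f b + 1)).
  have : (Num.bound `|g b - f b + 1|)%:R <= n%:R :> R by rewrite ler_nat.
  by have := ler_norm (g b - f b + 1); lra.
have /choice[b bP] n : exists y, B0 y /\ ~ A n y.
  by have /existsNP[y /not_implyP] := nB0 n; exists y.
have [g [gb gA]] := key b bP; have [n n4 ng] := gb 4%N.
have [m Am] : exists m, A m (b n).
  apply: contrapT => /forallNP nA; apply: cover; exists (b n) => //.
  by case: (bP n).
have := gA _ _ Am; rewrite ltr_norml => /andP[+ _].
have : 4%:R <= n%:R :> R by rewrite ler_nat.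
by lra.
Qed.

(** The memoryless strategy is not winning for the dense set [D], so alpha wins some run against it,
    and the sets played in that run form the base. *)
Lemma strongly_baire_countable_base :
  strongly_baire C -> exists A, countable_base A.
Proof.
move=> [_ _ [D dD nowin]].
have [f0 _] := @ex_cont_on (cst 0) (fun=> cvg_cst _).
have /choice[phi phiP] (U : set C) : exists t : set X * R * C, nonempty_open U ->
    [/\ S t.1.1, 0 < t.1.2, t.1.2 <= 1 & close_on t.1.1 t.1.2 t.2 `<=` U].
  have [[oU [f Uf]]|nU] := pselect (nonempty_open U); last by exists (set0, 0, f0).
  have [A [e [SA e0 AU]]] : exists A e, [/\ S A, 0 < e & close_on A e f `<=` U].
    by apply/nbhs_close_on; apply: open_nbhs_nbhs.
  exists (A, Num.min e 1, f) => _; split=> //=.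
  - by rewrite lt_min e0 ltr01.
  - by rewrite ge_min lexx orbT.
  - by move=> g fg; apply: AU => x /fg /lt_le_trans; apply; rewrite ge_min lexx.
(* A set [close_on A e f] need not be open, since a strict bound at each point is not uniform; its
   interior still contains the center. *)
pose sigma (s : seq (set C)) : set C :=
  let t := phi (last setT s) in (close_on t.1.1 t.1.2 t.2)°.
apply: contrapT => nobase; apply: nowin; exists sigma; split.
  move=> s ls; have oU : nonempty_open (last setT s).
    case: ls => [|t U _ oU _]; last by rewrite last_rcons.
    by split; [exact: openT|exists f0].
  have [SA e0 e1 AU] := phiP _ oU; split; last first.
    by apply: subset_trans AU; exact: interior_subset.
  split; first exact: open_interior.
  exists (phi (last setT s)).2; apply: nbhs_singleton; apply: nbhs_interior.
  by apply: close_on_nbhs => //; apply: (proj1 (proj1 S_base)).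
move=> V U run fol win; apply: nobase.
have oU n : nonempty_open (U n) by case: (run n).
exists (fun n => (phi (U n)).1.1); split=> [n|D' BD'].
  by case: (phiP _ (oU n)).
apply: (@alpha_win_covers D _ U V (fun n => (phi (U n)).2)
  (fun n => (phi (U n)).1.2)) => // n.
  by case: (phiP _ (oU n)).
(* [V 0] answers the empty sequence, so the answer to [U n] is [V n.+1]. *)
by rewrite fol /sigma /mkseq -addn1 iotaD map_cat /= last_cat.
Qed.

(** * The supremum distance of a countable base *)

Section base_distance.
Variable A : nat -> set X.
Hypothesis A_base : countable_base A.

(** The uniform distance on [A n] is capped at [n.+1%:R^-1]: this keeps the supremum finite and
    leaves finitely many [n] relevant at each scale. *)
Definition base_distance f g : R :=
  sup [set r | exists n, exists2 x, A n x & r = Num.min `|f x - g x| n.+1%:R^-1].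

Let A_cover x : exists n, A n x.
Proof.
have [_ Bcover _ _] := B_bornology.
have [D BD Dx] : (\bigcup_(A in B) A) x by rewrite Bcover.
by have [n An] := A_base.2 _ BD; exists n; exact: An.
Qed.

Let A_finite_union N : exists2 D, B D & forall n, (n <= N)%N -> A n `<=` D.
Proof.
have [[SB _] _] := S_base; have [_ _ BU _] := B_bornology.
elim: N => [|N [D BD DA]].
  exists (A 0); first exact: SB (A_base.1 _).
  by move=> n; rewrite leqn0 => /eqP ->.
exists (D `|` A N.+1); first exact: BU _ _ BD (SB _ (A_base.1 _)).
move=> n; rewrite leq_eqVlt => /predU1P[->|/DA AD] x; first by right.
by move/AD; left.
Qed.

Lemma base_distance_le f g c :
  (forall n x, A n x -> Num.min `|f x - g x| n.+1%:R^-1 <= c) ->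
  base_distance f g <= c.
Proof.
move=> fgc; apply: ge_sup => [|_ [n [x Ax ->]]]; last exact: fgc.
have [x _] := X_nonempty; have [n Ax] := A_cover x.
by exists (Num.min `|f x - g x| n.+1%:R^-1), n, x.
Qed.

Lemma le_base_distance f g n x :
  A n x -> Num.min `|f x - g x| n.+1%:R^-1 <= base_distance f g.
Proof.
move=> Ax; apply: ub_le_sup; last by exists n, x.
exists 1 => _ [m [y _ ->]]; rewrite ge_min; apply/orP; right.
by rewrite invf_le1 ?ler1n ?ltr0n.
Qed.

(** Below [n.+1%:R^-1] the cap at index [n] is not reached. *)
Lemma base_distance_lt f g n x e : A n x ->
  base_distance f g < Num.min e n.+1%:R^-1 -> `|f x - g x| < e.
Proof.
move=> Ax; rewrite lt_min => /andP[de dn].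
have := le_lt_trans (le_base_distance f g Ax) de.
rewrite gt_min => /orP[//|ne].
have := le_lt_trans (le_base_distance f g Ax) dn.
by rewrite gt_min ltxx orbF => /lt_trans; exact.
Qed.

Lemma base_distance_is_distance : is_distance base_distance.
Proof.
have nV0 n : 0 < n.+1%:R^-1 :> R by rewrite invr_gt0 ltr0n.
have d_ge0 f g : 0 <= base_distance f g.
  have [x _] := X_nonempty; have [n Ax] := A_cover x.
  apply: le_trans (le_base_distance f g Ax).
  by rewrite le_min normr_ge0 ltW.
split=> [f|f g fg|f g|g f h].
- apply/le_anti; rewrite d_ge0 andbT.
  by apply: base_distance_le => n x _; rewrite subrr normr0 ge_min lexx.
- apply: cont_on_eq => x; have [n Ax] := A_cover x.
  have := le_base_distance f g Ax; rewrite fg ge_min [_.+1%:R^-1 <= 0]leNgt nV0.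
  by rewrite orbF normr_le0 subr_eq0 => /eqP.
- by congr sup; apply/seteqP; split=> _ [n [x Ax ->]]; exists n, x => //;
    rewrite distrC.
(* Capping at a nonnegative constant preserves the triangle inequality. *)
- apply: base_distance_le => n x Ax.
  apply: le_trans (lerD (le_base_distance f g Ax) (le_base_distance g h Ax)).
  have := ler_distD (g x) (f x) (h x).
  have := normr_ge0 (f x - g x); have := normr_ge0 (g x - h x).
  have := nV0 n; move: n.+1%:R^-1 `|_| `|_| `|_| => v a b c v0 a0 b0 cab.
  by rewrite /Num.min; do 3 case: ifP => ?; lra.
Qed.

Lemma base_distance_nbhs : distance_nbhs base_distance.
Proof.
have [[SB _] _] := S_base.
move=> f E; split=> [/nbhs_close_on[D [e [SD e0 DE]]]|[e e0 H]].
  have [n Dn] := A_base.2 _ (SB _ SD).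
  exists (Num.min e n.+1%:R^-1); first by rewrite lt_min e0 invr_gt0 ltr0n.
  move=> g fg; apply: DE => x /Dn Ax; exact: base_distance_lt Ax fg.
have e20 : 0 < e / 2 by rewrite divr_gt0.
(* Indices above [N] contribute at most [e / 2] by the cap; those up to [N] are handled together on
   one member [D] of [B]. *)
have [N _ NP] := near_infty_natSinv_lt (PosNum e20).
have [D BD AD] := A_finite_union N.
apply: filterS (close_on_nbhs f BD e20) => g fg; apply: H.
suff /le_lt_trans : base_distance f g <= e / 2.
  by apply; rewrite ltr_pdivrMr// ltr_pMr// ltr1n.
apply: base_distance_le => n x Ax; rewrite ge_min; apply/orP.
have [nN|Nn] := leqP n N; [left|right].
  by apply: ltW; apply: fg; exact: AD Ax.
by apply: ltW; apply: NP; exact: ltnW.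
Qed.

(** A Cauchy sequence is uniformly Cauchy on each [A n], so its pointwise limit is continuous on
    every member of [B], hence on X by the BR property. *)
Lemma base_distance_complete : BR_space R B -> distance_complete base_distance.
Proof.
move=> BR u uC.
have uA n e : 0 < e ->
    exists N, forall m, (N <= m)%N -> forall x, A n x -> `|u N x - u m x| < e.
  move=> e0; have [|N NP] := uC (Num.min e n.+1%:R^-1).
    by rewrite lt_min e0 invr_gt0 ltr0n.
  by exists N => m Nm x Ax; exact: base_distance_lt Ax (NP _ Nm).
have /choice[F uF] x : exists y : R, (fun k => u k x) @ \oo --> y.
  have [n Ax] := A_cover x; apply/cvg_ex; apply/cauchy_cvgP.
  apply: cauchy_exP => e e0; have [N NP] := uA n e e0.
  by exists (u N x), N => // m /= Nm; exact: NP.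
have uFA n e : 0 < e ->
    exists N, forall m, (N <= m)%N -> forall x, A n x -> `|F x - u m x| < e.
  move=> e0; have e30 : 0 < e / 3 by rewrite divr_gt0.
  have [N NP] := uA n _ e30; exists N => m Nm x Ax.
  (* This index depends on [x], but it is only an intermediary: [N] serves all of [A n]. *)
  have /cvgrPdist_lt/(_ _ e30)[K _ KP] := uF x.
  have := KP _ (leq_maxl K N); have := NP _ (leq_maxr K N) _ Ax.
  have := NP m Nm x Ax.
  rewrite !ltr_norml => /andP[? ?] /andP[? ?] /andP[? ?].
  by apply/andP; split; lra.
have cF : continuous F.
  apply/BR => D BD; have [n Dn] := A_base.2 _ BD.
  apply: (continuous_subspaceW Dn).
  apply/subspace_continuousP => x Ax; apply/cvgrPdist_lt => e e0.
  have e30 : 0 < e / 3 by rewrite divr_gt0.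
  have [N NP] := uFA n _ e30.
  have /cvgrPdist_lt/(_ _ e30) := @cont_on_cts (u N) x.
  apply: filterS => y uy Ay; change (`|F x - F y| < e).
  have := NP _ (leqnn _) _ Ax; have := NP _ (leqnn _) _ Ay.
  by move: uy; rewrite !ltr_norml => /andP[? ?] /andP[? ?] /andP[? ?];
    apply/andP; split; lra.
have [f fF] := ex_cont_on cF; exists f => E /nbhs_close_on[D [e [SD e0 DE]]].
have [[SB _] _] := S_base; have [n Dn] := A_base.2 _ (SB _ SD).
have [N NP] := uFA n e e0; exists N => // m /= Nm; apply: DE => x /Dn Ax.
by rewrite fF; exact: NP.
Qed.

End base_distance.

(** * Klee's argument for the BR property *)

(* Take [p n.+1 = p n + (-1) ^+ n * f] on larger and larger sets [K n], so that
   the even and the odd terms are each stationary on every [K n]; when [K n] is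
   large enough both subsequences are d-Cauchy, and their limits differ by
   [f]. *)
Lemma complete_distance_BR (d : C -> C -> R) (A : nat -> set X) :
  distance_nbhs d -> distance_complete d -> countable_base A ->
  BR_space R B.
Proof.
move=> dn dc Abase f; split=> [cf D _|cf]; first exact: continuous_subspaceT.
have [[SB Sbase] _] := S_base; have [_ Bcover BU _] := B_bornology.
have nV0 n : 0 < n.+1%:R^-1 :> R by rewrite invr_gt0 ltr0n.
(* The enlarged set is chosen so that agreeing with [p] on it forces distance below [n.+1%:R^-1];
   including [A n] makes these sets cofinal in [B]. *)
have /choice[enl enlP] (t : C * nat * set X) : exists D, S t.2 ->
    [/\ S D, t.2 `|` A t.1.2 `<=` D & forall g,
      (forall x, D x -> g x = t.1.1 x) -> d t.1.1 g < t.1.2.+1%:R^-1].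
  case: t => [[p n] K] /=.
  have [SK|nK] := pselect (S K); last by exists K.
  have /nbhs_close_on[A' [e [SA' e0 A'p]]] :
      nbhs p [set g | d p g < n.+1%:R^-1].
    by apply/dn; exists n.+1%:R^-1.
  have [|D SD KD] := Sbase (K `|` A n `|` A').
    by apply/BU/SB => //; apply/BU; apply/SB => //; exact: Abase.1.
  exists D => _; split=> //.
    by move=> x Kx; apply: KD; left.
  move=> g gp; apply: A'p => x A'x.
  by rewrite gp ?subrr ?normr0//; apply: KD; right.
have /choice[ext extP] (t : C * nat * set X) : exists g : C, S t.2 ->
    forall x, t.2 x -> g x = t.1.1 x + (-1) ^+ t.1.2 * f x.
  case: t => [[p n] K] /=.
  have [SK|nK] := pselect (S K); last by exists p.
  have [||g gE] := @cont_on_extension K (fun x => p x + (-1) ^+ n * f x).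
  - by [].
  - move=> x; apply: cvgD; first exact: continuous_subspaceT (@cont_on_cts p) x.
    by apply: cvgM; [exact: cvg_cst|exact: cf (SB _ SK) x].
  - by exists g.
have [p0 _] := @ex_cont_on (cst 0) (fun=> cvg_cst _).
(* The new function is extended from the old set, and only then is the set enlarged to suit the new
   function. *)
pose fix st n : C * set X := if n is m.+1 then
    let q := ext ((st m).1, m, (st m).2) in (q, enl (q, m.+1, (st m).2))
  else (p0, enl (p0, 0, A 0)).
pose p n := (st n).1; pose K n := (st n).2.
have KP n : [/\ S (K n), A n `<=` K n & forall g,
      (forall x, K n x -> g x = p n x) -> d (p n) g < n.+1%:R^-1].
  elim: n => [|n [SK _ _]].
    have [SD AD ?] := enlP (p0, 0%N, A 0%N) (Abase.1 _).
    by split=> // x Ax; apply: AD; left.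
  have [SD AD ?] := enlP (p n.+1, n.+1, K n) SK.
  by split=> // x Ax; apply: AD; right.
have SK n : S (K n) by case: (KP n).
have K_incr m n : (m <= n)%N -> K m `<=` K n.
  move=> /subnKC <-; elim: (n - m)%N => [|k IH]; first by rewrite addn0.
  rewrite addnS; apply: subset_trans IH _ => x Kx.
  have [_ AD _] := enlP (p (m + k)%N.+1, (m + k).+1, K (m + k)%N) (SK _).
  by apply: AD; left.
have pS n x : K n x -> p n.+1 x = p n x + (-1) ^+ n * f x.
  exact: (extP (p n, n, K n) (SK n)).
have p_stat n j x : K n x -> p (n + j.*2)%N x = p n x.
  move=> Kx; elim: j => [|j IH]; first by rewrite double0 addn0.
  have Kj : K (n + j.*2)%N x by apply: K_incr Kx; exact: leq_addr.
  rewrite doubleS !addnS pS; last exact: K_incr Kj.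
  by rewrite pS// IH exprS; ring.
(* Taken at [k] equal to 0 and 1, for the even and the odd terms. *)
have limP k : exists l : C, forall j x,
    K (k + j.*2)%N x -> l x = p (k + j.*2)%N x.
  have [|l pl] := dc (fun j => p (k + j.*2)%N).
    move=> e e0; have [N _ NP] := near_infty_natSinv_lt (PosNum e0).
    exists N => n Nn.
    apply: (@lt_trans _ _ (k + N.*2)%N.+1%:R^-1); last first.
      by apply: NP => /=; rewrite -addnn addnA; exact: leq_addl.
    have [_ _] := KP (k + N.*2)%N; apply => x Kx.
    have -> : (k + n.*2 = k + N.*2 + (n - N).*2)%N.
      by rewrite -addnA -doubleD subnKC.
    exact: p_stat.
  (* The terms are constant from index [j] on at [x], so convergence to [l] forces equality
     there. *)
  exists l => j x Kx; apply/eqP; rewrite -subr_eq0 -normr_le0.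
  apply/ler_addgt0Pl => e e0; rewrite addr0.
  have [N _ NP] := pl _ (close_on_nbhs l (SB _ (SK (k + j.*2)%N)) e0).
  have := NP (maxn N j) (leq_maxl _ _) x Kx.
  have -> : (k + (maxn N j).*2 = k + j.*2 + (maxn N j - j).*2)%N.
    by rewrite -addnA -doubleD subnKC// leq_maxr.
  by rewrite p_stat// => /ltW.
have [l0 l0P] := limP 0; have [l1 l1P] := limP 1.
have -> : f = fun x => l1 x - l0 x.
  apply/funext => x.
  have [D BD Dx] : (\bigcup_(A in B) A) x by rewrite Bcover.
  have [n Dn] := Abase.2 _ BD.
  have K0 : K n.*2 x.
    have [_ AK _] := KP n; apply: (@K_incr n).
      by rewrite -addnn leq_addl.
    by apply: AK; exact: Dn.
  (* The step leaving the even index [n.*2] adds [f] with a positive sign. *)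
  rewrite (l0P n)// (l1P n); last by apply: K_incr K0.
  by rewrite add0n add1n pS// -signr_odd odd_double; ring.
by move=> x; apply: cvgB; exact: cont_on_cts.
Qed.

End cont_on_theory.

(* Normal spaces are T1. *)
Theorem theorem4p1 (R : realType) (X : topologicalType) (B S : set (set X))
    (X_nonempty : [set: X] !=set0)
    (X_T1 : accessible_space X) (X_normal : normal_space X)
    (B_bornology : bornology B) (S_base : closed_bornology_base B S) :
  completely_metrizable R (cont_on R B) <->
  strongly_baire (cont_on R B) /\ BR_space R B.
Proof.
(* Both directions use the countable base: one to exhaust X in Klee's argument, the other to define
   the distance. *)
have baire_base := strongly_baire_countable_base X_nonempty X_T1 X_normal
  B_bornology S_base (R := R).
split=> [/completely_metrizableP[d [d_dist d_nbhs d_complete]]|[baire BR]].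
- have baire := complete_distance_strongly_baire d_dist d_nbhs d_complete.
  split=> //; have [A A_base] := baire_base baire.
  exact: (complete_distance_BR X_nonempty X_normal B_bornology S_base
    d_nbhs d_complete A_base).
- have [A A_base] := baire_base baire.
  apply/completely_metrizableP; exists (base_distance A); split.
  + exact: (base_distance_is_distance X_nonempty B_bornology A_base).
  + exact: (base_distance_nbhs X_nonempty B_bornology S_base A_base).
  + exact: (base_distance_complete X_nonempty B_bornology S_base A_base BR).
Qed.
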